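(* Let $A$ be a quadriculated annulus admitting at least one domino tiling, let $\xi$ be a cut of $A$, and let $f_{\max}$ and $f_{\min}$ be the maximum and minimum values of the flux $\phi(t,\xi)$ among all tilings $t$ of $A$. Then there exist cuts $\xi_{\max}$ and $\xi_{\min}$ of $A$ such that no tiling of flux $f_{\max}$ trespasses $\xi_{\max}$ and no tiling of flux $f_{\min}$ trespasses $\xi_{\min}$.
   Context: A quadriculated annulus $A$ is a compact surface homeomorphic to $S^1\times[0,1]$, embedded in $\mathbb{R}^2$, obtained by gluing unit squares along sides so that interior vertices belong to exactly four squares; its squares are colored black and white with side-adjacent squares of opposite colors. A cut is a simple path of vertices of $A$ (consecutive vertices joined by sides of squares) going from the outer boundary to the inner boundary and having exactly one vertex on each boundary component. In each domino of a tiling draw the arrow from its black square to its white square. The flux $\phi(t,\xi)$ of a tiling $t$ relative to a cut $\xi$ is the number of domino arrows crossing $\xi$ counterclockwise (around the hole of $A$) minus the number crossing $\xi$ clockwise. A tiling trespasses a cut if some domino of the tiling has its two squares sharing an edge of the cut. *)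

(* Defs.v *)
From HB Require Import structures.
From mathcomp Require Import all_boot all_order all_algebra.
From mathcomp Require Import all_classical all_reals all_analysis.
From Stdlib Require Import Relation_Operators.

Set Implicit Arguments.
Unset Strict Implicit.
Unset Printing Implicit Defensive.

Import Order.TTheory GRing.Theory Num.Theory.
Import numFieldNormedType.Exports.
Local Open Scope classical_set_scope.
Local Open Scope ring_scope.

(* The corners of the unit square [0,1]^2 are numbered 0, 1, 2, 3
   counterclockwise from (0,0); side k goes from corner k to corner k+1 mod 4.
   A pair (s, k) stands for side k of the square s, directed counterclockwise
   along s (so that s lies on its left); it also stands for corner k of s,
   which is the starting point of that side. *)
Definition side (S : finType) : finType := (S * 'I_4)%type.

Definition next_side (S : finType) (d : side S) : side S := (d.1, ordS d.2).

Definition unit_square (R : realType) : set (R * R) :=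
  [set p | 0 <= p.1 <= 1 /\ 0 <= p.2 <= 1].

Definition corner_pt (R : realType) (k : 'I_4) : R * R :=
  ((0 < k < 3)%N%:R, (1 < k)%N%:R).

Definition side_pt (R : realType) (k : 'I_4) (x : R) : R * R :=
  (1 - x) *: corner_pt R k + x *: corner_pt R (ordS k).

Section Gluing.
Variables (S : finType) (glue : side S -> option (side S)).

(* Glued sides are identified isometrically, with opposite directions. *)
Inductive glue_step (R : realType) : S * (R * R) -> S * (R * R) -> Prop :=
  GlueStep (d e : side S) (x : R) of glue d = Some e & 0 <= x <= 1 :
    glue_step (d.1, side_pt d.2 x) (e.1, side_pt e.2 (1 - x)).

Definition glued_pts (R : realType) : S * (R * R) -> S * (R * R) -> Prop :=
  clos_refl_sym_trans _ (@glue_step R).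

(* The start of d is glued to the end of the side glued to d. *)
Definition corner_step (c c' : side S) : bool :=
  if glue c is Some e then c' == next_side e else false.

Definition same_vertex : rel (side S) :=
  connect (fun c c' => corner_step c c' || corner_step c' c).

(* A vertex of the surface is a class of identified corners of squares. *)
Definition side_tail (d : side S) : {set side S} :=
  [set c | same_vertex d c]%SET.
Definition side_head (d : side S) : {set side S} := side_tail (next_side d).

Definition boundary_vertex (v : {set side S}) : bool :=
  [exists d, (glue d == None) && ((v == side_tail d) || (v == side_head d))].

Definition boundary_adj (v w : {set side S}) : bool :=
  [exists d, (glue d == None) &&
     ((v == side_tail d) && (w == side_head d) ||
      (w == side_tail d) && (v == side_head d))].

Definition same_boundary : rel {set side S} := connect boundary_adj.

End Gluing.

Definition homeomorphic (T U : topologicalType) (A : set T) (B : set U) :=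
  exists (f : T -> U) (g : U -> T),
    [/\ {within A, continuous f} /\ {within B, continuous g},
        (forall x, A x -> B (f x)), (forall y, B y -> A (g y)),
        (forall x, A x -> g (f x) = x) & (forall y, B y -> f (g y) = y)].

Definition circle (R : realType) : set (R * R) :=
  [set p | p.1 ^+ 2 + p.2 ^+ 2 = 1].

(* The image under f of the circle inscribed in the unit square, run
   counterclockwise, winds once counterclockwise around the image of the
   center. *)
Definition orientation_preserving (R : realType) (f : R * R -> R * R) :=
  exists rho theta : R -> R,
    [/\ continuous theta,
        (forall t, 0 < rho t),
        theta (2 * pi) = theta 0 + 2 * pi &
        forall t, f (2^-1 + 2^-1 * cos t, 2^-1 + 2^-1 * sin t) =
                  f (2^-1, 2^-1) +
                  (rho t * cos (theta t), rho t * sin (theta t))].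

(* Unit squares are glued abstractly along sides; [emb] is the resulting
   embedding of the quotient in the plane, given square by square (on
   [unit_square]). Since the squares are compact, a continuous map to the plane
   whose fibers are the classes of the gluing relation is an embedding of the
   quotient. *)
Record quadriculated_annulus (R : realType) := QuadriculatedAnnulus {
  square : finType;
  glue : side square -> option (side square);
  black : pred square;
  emb : square -> R * R -> R * R;
  glue_sym : forall d e, glue d = Some e -> glue e = Some d;
  black_glue : forall d e, glue d = Some e -> black e.1 = ~~ black d.1;
  (* Counting corners: a square meeting a vertex at two of its corners counts
     twice. *)
  interior_vertex4 :
    forall c, ~~ boundary_vertex glue (side_tail glue c) ->
      #|side_tail glue c| = 4%N;
  emb_continuous : forall s, {within @unit_square R, continuous (emb s)};
  emb_glue : forall s s' p p', unit_square p -> unit_square p' ->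
    (emb s p = emb s' p' <-> glued_pts glue (s, p) (s', p'));
  emb_orientation : forall s, orientation_preserving (emb s);
  emb_annulus :
    homeomorphic (\bigcup_(s in [set: square]) (emb s @` @unit_square R))
                 (@circle R `*` `[(0 : R), 1])
}.

Arguments glue [R] A d : rename.

Section Annulus.
Variables (R : realType) (A : quadriculated_annulus R).

Definition vertex := {set side (square A)}.

Definition region : set (R * R) :=
  \bigcup_(s in [set: square A]) (emb s @` @unit_square R).

Definition unbounded_complement : set (R * R) :=
  [set p | (~` region) p /\ ~ bounded_set (connected_component (~` region) p)].

(* The outer boundary is the boundary component adjacent to the unbounded
   component of the complement; the inner boundary is the other one. *)
Definition outer_vertex (v : vertex) : Prop :=
  boundary_vertex (glue A) v /\
  exists c : side (square A),
    same_boundary (glue A) v (side_tail (glue A) c) /\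
    closure unbounded_complement (emb c.1 (corner_pt R c.2)).

Definition inner_vertex (v : vertex) : Prop :=
  boundary_vertex (glue A) v /\ ~ outer_vertex v.

(* A path of vertices is given by its successive directed edges, so as to
   distinguish edges with the same endpoints. Each interior edge occurs in both
   directions, once for each of the two squares sharing it. An edge on the
   boundary occurs in one direction only, but it cannot belong to a cut. *)
Definition path_vertices (xi : seq (side (square A))) : seq vertex :=
  if xi is d :: _ then side_tail (glue A) d :: map (side_head (glue A)) xi
  else [::].

Definition is_cut (xi : seq (side (square A))) : Prop :=
  let vs := path_vertices xi in
  let v0 := head finset.set0 vs in
  let v1 := last finset.set0 vs in
  [/\ sorted (fun d e => side_head (glue A) d == side_tail (glue A) e) xi,
      uniq vs,
      outer_vertex v0 /\ inner_vertex v1,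
      (forall v, v \in vs -> outer_vertex v -> v = v0) &
      (forall v, v \in vs -> inner_vertex v -> v = v1)].

(* A domino is a pair of squares glued along an edge. A tiling is given by the
   set of the sides (both of the two glued sides) separating the squares of its
   dominoes. *)
Definition is_tiling (t : {set side (square A)}) : Prop :=
  (forall d, d \in t -> exists2 e, glue A d = Some e & e \in t) /\
  (forall s : square A, exists! k : 'I_4, (s, k) \in t).

(* A cut is directed inwards, so going from its left to its right is going
   counterclockwise around the hole; the square d.1 lies on the left of d. *)
Definition flux (t : {set side (square A)}) (xi : seq (side (square A))) : int :=
  (count (fun d => (d \in t) && black d.1) xi)%:Z -
  (count (fun d => (d \in t) && ~~ black d.1) xi)%:Z.

Definition trespasses (t : {set side (square A)}) (xi : seq (side (square A))) :
  bool := has (fun d => d \in t) xi.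

Definition is_max_flux (xi : seq (side (square A))) (f : int) : Prop :=
  (exists2 t, is_tiling t & flux t xi = f) /\
  (forall t, is_tiling t -> flux t xi <= f).

Definition is_min_flux (xi : seq (side (square A))) (f : int) : Prop :=
  (exists2 t, is_tiling t & flux t xi = f) /\
  (forall t, is_tiling t -> f <= flux t xi).

End Annulus.

(* Main.v *)
Require Import Defs.
From mathcomp Require Import all_boot all_order all_algebra.
From mathcomp Require Import all_classical all_reals all_analysis.
From mathcomp Require Import ring lra zify.
From Stdlib Require Import Relation_Operators.
(* [glue] is also a function of mathcomp.classical. *)
Import Defs.

(* Give each domino of a tiling the sign of the color of its left square; this
   is a 1-form [domino_form] whose integral along a cut is the flux. For two
   tilings the difference of the forms is a cocycle relative to the boundary,
   and on an annulus these form, up to coboundaries, a group of rank one: so two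
   tilings with the same flux relative to one cut have the same flux relative to
   every cut.

   Rank one is proved dually. An integer dual cocycle (a function on sides with
   zero sum around each interior vertex) gives a map from the surface to R/Z,
   interpolated bilinearly from values at the corners; it lifts to R over each
   half of the annulus S^1 x [0,1], and a combination of two cocycles with zero
   monodromy lifts globally, hence is a coboundary.

   If t has maximal flux, some path from the outer to the inner boundary has
   all its sides d satisfying (d in t) = (d.1 is black): otherwise toggling t
   along the sides leaving the set of vertices so reachable increases the flux
   by one. On such a path the flux is the largest possible, so every tiling of
   maximal flux behaves on it like t; pushing the path around the black squares
   of the dominoes it crosses yields a cut which no such tiling trespasses. The
   minimum is the same statement with the colors exchanged. *)

Set Implicit Arguments.
Unset Strict Implicit.
Unset Printing Implicit Defensive.

Import Order.TTheory GRing.Theory Num.Theory.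
Import numFieldNormedType.Exports.
Local Open Scope classical_set_scope.
Local Open Scope ring_scope.

(** * Lifting maps to the reals modulo the integers *)

Section ModuloIntegers.
Variable R : realType.
Implicit Types x y e : R.

Definition nearest_int x : int := Num.floor (x + 2^-1).
(** The representative of [x] modulo 1 in [-1/2, 1/2); its absolute value, the distance from [x] to
    the integers, serves as the metric of R/Z. *)
Definition int_rem x : R := x - (nearest_int x)%:~R.

Lemma nearest_intE x (n : int) : `|x - n%:~R| < 2^-1 -> nearest_int x = n.
Proof.
rewrite ltr_norml => /andP[h1 h2]; apply: floor_def.
by rewrite intrD; apply/andP; split; lra.
Qed.

Lemma int_rem_le x : `|int_rem x| <= 2^-1.
Proof.
rewrite /int_rem /nearest_int ler_norml.
have := floor_le (x + 2^-1); have := floorD1_gt (x + 2^-1).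
rewrite intrD => h1 h2; apply/andP; split; lra.
Qed.

Lemma int_remE x (n : int) : `|x - n%:~R| < 2^-1 -> int_rem x = x - n%:~R.
Proof. by move=> h; rewrite /int_rem (nearest_intE h). Qed.

Lemma int_rem_int (n : int) : int_rem n%:~R = 0.
Proof. by rewrite (@int_remE _ n) subrr ?normr0. Qed.

Lemma int_rem_lip x y : `|int_rem x| < 4^-1 -> `|int_rem (y - x)| < 4^-1 ->
  int_rem y - int_rem x = int_rem (y - x).
Proof.
move=> hx hy; rewrite (@int_remE y (nearest_int x + nearest_int (y - x))).
  by rewrite /int_rem intrD; lra.
move: hx hy; rewrite /int_rem intrD !ltr_norml => /andP[? ?] /andP[? ?].
by apply/andP; split; lra.
Qed.

Lemma int_rem_min x (n : int) : `|int_rem x| <= `|x - n%:~R|.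
Proof.
have [h|h] := ltP `|x - n%:~R| 2^-1; first by rewrite (int_remE h).
exact: le_trans (int_rem_le x) h.
Qed.

Lemma int_remD x y : `|int_rem (x + y)| <= `|int_rem x| + `|int_rem y|.
Proof.
apply: le_trans (int_rem_min _ (nearest_int x + nearest_int y)) _.
apply: le_trans (ler_normD _ _).
by rewrite le_eqVlt; apply/orP; left; rewrite /int_rem intrD; apply/eqP; congr (`| _ |); lra.
Qed.

Lemma int_remN x : `|int_rem (- x)| = `|int_rem x|.
Proof.
suff h y : `|int_rem (- y)| <= `|int_rem y|.
  by apply/eqP; rewrite eq_le h -{1}[x]opprK h.
apply: le_trans (int_rem_min _ (- nearest_int y)) _.
by rewrite /int_rem intrN -opprD normrN.
Qed.

Lemma int_remB x y : `|int_rem (x - y)| <= `|int_rem x| + `|int_rem y|.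
Proof. by rewrite -(int_remN y) int_remD. Qed.

Lemma int_remDint x (n : int) : int_rem (x + n%:~R) = int_rem x.
Proof.
rewrite /int_rem /nearest_int [x + _ + 2^-1]addrAC.
have -> : Num.floor (x + 2^-1 + n%:~R) = Num.floor (x + 2^-1) + n.
  apply: floor_def; rewrite !intrD.
  have := floor_le (x + 2^-1); have := floorD1_gt (x + 2^-1).
  by rewrite intrD => h1 h2; apply/andP; split; lra.
by rewrite intrD; lra.
Qed.

(** [H] represents a map to R/Z: it may jump by integers. *)
Definition continuous_mod1 (T : topologicalType) (H : T -> R) :=
  forall q e, 0 < e -> \forall q' \near q, `|int_rem (H q' - H q)| < e.

Lemma cvg_sum_cond (T I : Type) (F : set_system T) (FF : Filter F) (r : seq I)
    (P : pred I) (f : I -> T -> R) (l : I -> R) :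
  (forall i, P i -> f i x @[x --> F] --> l i) ->
  \sum_(i <- r | P i) f i x @[x --> F] --> \sum_(i <- r | P i) l i.
Proof.
move=> fl; elim: r => [|i r IH].
  by under eq_cvg do rewrite big_nil; rewrite big_nil; exact: cvg_cst.
under eq_cvg do rewrite big_cons; rewrite big_cons.
by case: ifPn => // Pi; apply: cvgD => //; exact: fl.
Qed.

(* Along the segment from 0 to q, cut in N equal steps on which H varies by
   less than 1/4 modulo 1, the lift is the sum of the increments reduced to
   [-1/2, 1/2). *)
Lemma continuous_mod1_lift (V : normedModType R) (K : set V) (H : V -> R) :
  compact K -> (forall t q, 0 <= t <= 1 -> K q -> K (t *: q)) ->
  continuous_mod1 H ->
  exists G : V -> R, (forall q, K q -> {for q, continuous G}) /\
    forall q, exists n : int, G q = H q + n%:~R.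
Proof.
move=> cK starK cH.
have [d d0 dP] : exists2 d : R, 0 < d & forall q q', K q -> `|q - q'| < d ->
    `|int_rem (H q' - H q)| < 4^-1.
  (* Uniform continuity modulo 1 from compactness; two variations below 1/8 add up to less than
     1/4. *)
  have /compact_near_coveringP/(_ _ (0^'+ : set_system R)
    (fun d q => forall q', `|q - q'| < d -> `|int_rem (H q' - H q)| < 4^-1) _) := cK.
  case.
    move=> q Kq.
    have /nbhs_ballP[r /= r0 rP] := cH q 8^-1 ltac:(lra).
    exists (ball q (r / 2), [set x | x < r / 2]) => /=.
      split; first by apply: nbhsx_ballx; lra.
      by apply: nbhs_right_lt; lra.
    move=> [q' x] /= [q'q xr] q'' q''q'.
    have -> : H q'' - H q' = (H q'' - H q) - (H q' - H q) by lra.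
    apply: le_lt_trans (int_remB _ _) _.
    have h1 : `|int_rem (H q' - H q)| < 8^-1.
      by apply: rP; apply: le_ball q'q; lra.
    have h2 : `|int_rem (H q'' - H q)| < 8^-1.
      apply: rP; rewrite -ball_normE /=.
      move: q'q; rewrite -ball_normE /= => q'q.
      rewrite -(subrKA q'); apply: le_lt_trans (ler_normD _ _) _; lra.
    lra.
  move=> e /= e0 eP; exists (e / 2); first by lra.
  move=> q q' Kq; apply: (eP (e / 2) _ _ q Kq) => /=; last by lra.
  by rewrite sub0r normrN gtr0_norm; lra.
have [M M0 MP] : exists2 M : R, 0 < M & forall q, K q -> `|q| <= M.
  have [M [_ MP]] := compact_bounded cK.
  exists (Num.max 1 (M + 1)); first by rewrite lt_max ltr01.
  by move=> q Kq; apply: MP => //; rewrite lt_max; apply/orP; right; lra.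
(* Cutting the segment from 0 to [q] in [N.+1] steps makes each step shorter than [d]. *)
have [N NP] : exists N : nat, M / N.+1%:R < d.
  exists (Num.truncn (M / d)).
  by rewrite ltr_pdivrMr // -ltr_pdivrMl // mulrC truncnS_gt.
pose step (k : nat) (q : V) := (k%:R / N.+1%:R) *: q.
pose G q := H 0 + \sum_(k < N.+1) int_rem (H (step k.+1 q) - H (step k q)).
exists G; split.
  move=> q Kq.
  rewrite /prop_for /continuous_at /G; apply: cvgD; first exact: cvg_cst.
  apply: cvg_sum_cond => k _ /=.
  have [sk sk1] : K (step k q) /\ `|step k q - step k.+1 q| < d.
    split.
      apply: starK => //; rewrite divr_ge0 //=.
      by rewrite ler_pdivrMr // mul1r ler_nat ltnW.
    rewrite /step -scalerBl normrZ.
    rewrite -mulrBl -[k.+1]addn1 natrD opprD addrA subrr sub0r mulN1r normrN.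
    rewrite gtr0_norm ?invr_gt0 //.
    apply: le_lt_trans NP; rewrite mulrC ler_pM2r ?invr_gt0 //; exact: MP.
  have small := dP _ _ sk sk1.
  have stepc j : step j x @[x --> q] --> step j q.
    by apply: cvgZl_tmp; exact: cvg_id.
  apply/cvgrPdist_lt => e e0.
  (* The bound 1/4 lets [int_rem_lip] turn closeness of the increments modulo 1 into closeness of
     their reduced values. *)
  pose e' := Num.min e 4^-1.
  have e'0 : 0 < e' by rewrite lt_min e0; lra.
  have h1 := stepc k _ (cH (step k q) (e' / 2) ltac:(lra)).
  have h2 := stepc k.+1 _ (cH (step k.+1 q) (e' / 2) ltac:(lra)).
  near=> q'.
  have h1' : `|int_rem (H (step k q') - H (step k q))| < e' / 2.
    by near: q'; exact: h1.
  have h2' : `|int_rem (H (step k.+1 q') - H (step k.+1 q))| < e' / 2.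
    by near: q'; exact: h2.
  have h3 : `|int_rem ((H (step k.+1 q') - H (step k q')) -
       (H (step k.+1 q) - H (step k q)))| < e'.
    rewrite (_ : _ - _ = (H (step k.+1 q') - H (step k.+1 q)) -
       (H (step k q') - H (step k q))); last by lra.
    by apply: le_lt_trans (int_remB _ _) _; lra.
  rewrite distrC int_rem_lip //.
    by apply: lt_le_trans h3 _; rewrite ge_min lexx.
  by apply: lt_le_trans h3 _; rewrite ge_min lexx orbT.
move=> q.
exists (- \sum_(0 <= k < N.+1) nearest_int (H (step k.+1 q) - H (step k q))).
rewrite /G -(big_mkord xpredT (fun k => int_rem (H (step k.+1 q) - H (step k q)))).
rewrite /int_rem sumrB telescope_sumr // rmorphN rmorph_sum /=.
rewrite /step mul0r scale0r divff ?pnatr_eq0 // scale1r; lra.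
Unshelve. all: by end_near.
Qed.

End ModuloIntegers.

(** * Vertices and dual cocycles *)

(** The columns of the cokernel matrix of [m] are test vectors [w]; a row killed by all of them lies
    in the row space of [m]. *)
Lemma fredholm_alternative (F : fieldType) (T T' : finType) (M : T -> T' -> F)
    (b : T' -> F) :
  (forall w : T' -> F, (forall i, \sum_j M i j * w j = 0) ->
     \sum_j b j * w j = 0) ->
  exists x : T -> F, forall j, \sum_i x i * M i j = b j.
Proof.
move=> bM.
have sum_enum (I : finType) (f : I -> F) :
    \sum_i f i = \sum_(i < #|I|) f (enum_val i).
  rewrite [RHS](reindex enum_rank) /=; last exact: (onW_bij _ (@enum_rank_bij _)).
  by apply: eq_bigr => i _; rewrite enum_rankK.
pose m := \matrix_(i < #|T|, j < #|T'|) M (enum_val i) (enum_val j).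
pose bm := \row_(j < #|T'|) b (enum_val j).
have /submxP[x xE] : (bm <= m)%MS.
  rewrite submxE; apply/eqP/rowP => k; rewrite !mxE.
  have := bM (fun j => cokermx m (enum_rank j) k) _.
  rewrite sum_enum => h; rewrite -[RHS]h.
    by apply: eq_bigr => j _; rewrite mxE enum_valK.
  move=> i; have /matrixP/(_ (enum_rank i) k) := mulmx_coker m.
  rewrite !mxE => {2}<-; rewrite sum_enum.
  by apply: eq_bigr => j _; rewrite [m _ _]mxE enum_rankK enum_valK.
exists (fun i => x 0 (enum_rank i)) => j.
have /rowP/(_ (enum_rank j)) := xE.
rewrite !mxE enum_rankK => ->; rewrite sum_enum.
by apply: eq_bigr => i _; rewrite !mxE enum_valK enum_rankK.
Qed.

Section Vertices.
Variables (S : finType) (glue : side S -> option (side S)).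
Hypothesis glue_sym : forall d e, glue d = Some e -> glue e = Some d.
Local Notation tail := (side_tail glue).
Local Notation head := (side_head glue).

Lemma next_side_inj : injective (@next_side S).
Proof.
move=> [s i] [s' i'] ss'; have /= -> := congr1 fst ss'.
by have /= /(can_inj (ordSK (n := 4))) -> := congr1 snd ss'.
Qed.

Lemma same_vertex_sym : connect_sym (fun c c' =>
  corner_step glue c c' || corner_step glue c' c).
Proof. by apply: sym_connect_sym => x y; rewrite orbC. Qed.

Lemma side_tailE c c' : (tail c == tail c') = same_vertex glue c c'.
Proof.
apply/eqP/idP => [/finset.setP/(_ c')|cc'].
  by rewrite !inE => ->; exact: connect0.
by apply/finset.setP => x; rewrite !inE; exact: (same_connect same_vertex_sym cc').
Qed.

Lemma glue_tail d e : glue d = Some e -> tail d = head e.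
Proof.
move=> de; apply/eqP; rewrite side_tailE; apply: connect1.
by rewrite /corner_step de eqxx.
Qed.

Lemma glue_head d e : glue d = Some e -> head d = tail e.
Proof. by move=> /glue_sym/glue_tail. Qed.

Lemma boundary_tail d : glue d = None -> boundary_vertex glue (tail d).
Proof. by move=> dN; apply/existsP; exists d; rewrite dN !eqxx. Qed.

Lemma boundary_head d : glue d = None -> boundary_vertex glue (head d).
Proof. by move=> dN; apply/existsP; exists d; rewrite dN !eqxx orbT. Qed.

Definition dual_cocycle (eta : side S -> int) :=
  (forall d e, glue d = Some e -> eta e = - eta d) /\
  (forall c, ~~ boundary_vertex glue (tail c) -> \sum_(x in tail c) eta x = 0).

(* The potential exists because a weight orthogonal to all coboundaries is
   constant on each vertex and vanishes on the boundary vertices. *)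
Lemma dual_cocycle_corners (R : realType) (eta : side S -> int) :
  dual_cocycle eta ->
  exists l : side S -> R, forall c e, glue c = Some e ->
    l (next_side e) = l c + (eta c)%:~R.
Proof.
move=> [eta_anti eta_closed].
pose M c' c : R := if glue c is Some e then (c' == next_side e)%:R - (c' == c)%:R
  else 0.
pose b c : R := if glue c is Some e then (eta c)%:~R else 0.
have [|l lP] := @fredholm_alternative R (side S) (side S) M b.
  move=> w wM.
  pose v c := if glue c is Some e then w c else 0.
  (* Orthogonality of [w] to the coboundary of the indicator of [c']. The sum has at most one term,
     since [glue] and [next_side] are injective. *)
  have vE c' : v c' = \sum_(c | if glue c is Some e then c' == next_side e else false) v c.
    have := wM c'.
    rewrite (eq_bigr (fun c =>
       (if if glue c is Some e then c' == next_side e else false then v c else 0)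
       - (if c == c' then v c else 0))); last first.
      move=> c _; rewrite /M /v; case: (glue c) => [e|]; last first.
        by rewrite mul0r if_same subrr.
      by rewrite mulrBl !mulr_natl !mulrb [c == c']eq_sym.
    rewrite sumrB => /eqP; rewrite subr_eq0 => /eqP.
    rewrite -[X in _ = X -> _]big_mkcond -[X in X = _ -> _]big_mkcond /=.
    by rewrite big_pred1_eq.
  have vglue c e : glue c = Some e -> v (next_side e) = v c.
    move=> ce; rewrite vE (big_pred1 c) // => c' /=.
    case ce' : (glue c') => [e'|]; last first.
      by apply/esym/eqP => cc'; rewrite cc' ce in ce'.
    apply/idP/idP => [/eqP/next_side_inj ee'|/eqP cc'].
      by move: (glue_sym ce'); rewrite -ee' (glue_sym ce) => -[->].
    by move: ce'; rewrite cc' ce => -[->].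
  have vconst c c' : tail c = tail c' -> v c = v c'.
    move/eqP; rewrite side_tailE => /connectP[p pP ->] {c'}.
    elim: p c pP => //= x p IH c /andP[cx xp]; rewrite -(IH _ xp).
    move: cx; rewrite /corner_step => /orP[].
      by case ce : (glue c) => [e|//] /eqP ->; rewrite (vglue _ _ ce).
    by case ce : (glue x) => [e|//] /eqP ->; rewrite (vglue _ _ ce).
  rewrite (eq_bigr (fun c => (eta c)%:~R * v c)); last first.
    by move=> c _; rewrite /b /v; case: (glue c) => *; rewrite ?mul0r ?mulr0.
  rewrite (partition_big (fun c => tail c) xpredT) //= big1 // => x _.
  have [/existsP[c /eqP <-{x}]|/existsPn h] := boolP [exists c, tail c == x];
    last by rewrite big1 // => c cx; move: (h c); rewrite cx.
  rewrite (eq_bigr (fun i => (eta i)%:~R * v c)); last first.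
    by move=> i /eqP /vconst ->.
  rewrite -mulr_suml.
  have [/existsP[d /andP[/eqP dN /orP[] /eqP cd]]|cN] := boolP (boundary_vertex glue (tail c)).
  - by rewrite (vconst _ _ cd) /v dN mulr0.
  (* As [d] is unglued, no glued side has a partner ending at [next_side d], so the sum in [vE] is
     empty. *)
  - rewrite (vconst _ _ cd) vE [X in _ * X]big1 ?mulr0 // => c'.
    case ce : (glue c') => [e|//] /eqP/next_side_inj de.
    by move: (glue_sym ce); rewrite -de dN.
  rewrite (eq_bigl (mem (tail c))); last first.
    by move=> i; rewrite eq_sym side_tailE !inE.
  by rewrite -rmorph_sum /= eta_closed // mul0r.
exists l => c e ce; apply/eqP; rewrite addrC -subr_eq; apply/eqP.
have := lP c; rewrite /M /b ce => <-.
under eq_bigr do rewrite mulrBr !mulr_natr !mulrb.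
by rewrite sumrB -!big_mkcond /= !big_pred1_eq.
Qed.

End Vertices.

(** * The first cohomology of a quadriculated annulus *)

Lemma cvg_within_comp (T U V : topologicalType) (F : set_system T)
    (FF : Filter F) (A : set U) (f : T -> U) (g : U -> V) (y : U) :
  f x @[x --> F] --> y -> (\forall x \near F, A (f x)) -> A y ->
  {within A, continuous g} -> g (f x) @[x --> F] --> g y.
Proof.
move=> fy Af Ay /subspace_continuousP/(_ y Ay) gA P Pgy.
have := fy _ (gA _ Pgy); rewrite /= /within /=.
by apply: filterS2 Af => x Afx; apply.
Qed.

(** * Preliminaries on real functions *)

Section RealLine.
Variable R : realType.

Lemma int_valued_continuous (phi : R -> R) :
  {within `[0, 1], continuous phi} ->
  (forall t : R, 0 <= t <= 1 -> exists n : int, phi t = n%:~R) ->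
  forall t : R, 0 <= t <= 1 -> phi t = phi 0.
Proof.
move=> cphi phiZ t /andP[t0 t1].
have [n0 n0E] := phiZ 0 ltac:(by rewrite lexx ler01).
have [nt ntE] := phiZ t ltac:(by rewrite t0 t1).
have cphi' : {within `[0, t], continuous phi}.
  apply: continuous_subspaceW cphi => x /=; rewrite !in_itv /= => /andP[-> xt] /=.
  exact: le_trans xt t1.
apply/eqP; apply: contraT => neq.
have [k kmin kmax] : exists2 k : int, Num.min (phi 0) (phi t) = k%:~R &
    k%:~R + 1 <= Num.max (phi 0) (phi t).
  move: neq; rewrite n0E ntE eqr_int; case: ltgtP => // lt _.
  - have lt' : (nt%:~R : R) <= n0%:~R by rewrite ler_int ltW.
    exists nt; first exact: (min_r lt').
    by rewrite (max_l lt') -[1]/(1%:~R) -intrD ler_int lezD1.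
  - have lt' : (n0%:~R : R) <= nt%:~R by rewrite ler_int ltW.
    exists n0; first exact: (min_l lt').
    by rewrite (max_r lt') -[1]/(1%:~R) -intrD ler_int lezD1.
(* A non-constant [phi] would take a half-integer value. *)
have [c] : exists2 c, c \in `[0, t] & phi c = k%:~R + 2^-1.
  by apply: IVT => //; rewrite kmin; apply/andP; split; lra.
rewrite in_itv /= => /andP[c0 ct].
have [nc ->] := phiZ c ltac:(by rewrite c0 (le_trans ct)).
move=> e.
have h1 : (k < nc)%R by rewrite -(ltr_int R); lra.
have h2 : (nc < k + 1)%R by rewrite -(ltr_int R) intrD; lra.
by move: h2; rewrite ltzD1 leNgt h1.
Qed.

Definition clamp (a b x : R) : R := Num.max a (Num.min b x).

Lemma clamp_continuous a b : continuous (clamp a b).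
Proof.
move=> x; apply: (@continuous_max R R (fun=> a) (fun x => Num.min b x)).
  exact: cst_continuous.
apply: (@continuous_min R R (fun=> b) (fun x => x)); first exact: cst_continuous.
exact: cvg_id.
Qed.

Lemma clampP a b x : a <= b -> a <= clamp a b x <= b.
Proof. by move=> ab; rewrite /clamp le_max lexx /= ge_max ab ge_min lexx. Qed.

Lemma clamp_id a b x : a <= x <= b -> clamp a b x = x.
Proof. by case/andP=> ax xb; rewrite /clamp (min_idPr xb) (max_idPr ax). Qed.

Lemma itv_rect_compact (a b c d : R) :
  compact [set q : R * R | a <= q.1 <= b /\ c <= q.2 <= d].
Proof.
rewrite (_ : [set _ | _] = `[a, b] `*` `[c, d]).
  by apply: compact_setX; exact: segment_compact.
by apply/seteqP; split=> q /=; rewrite !in_itv.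
Qed.

Lemma int_rem_continuous : continuous (fun x : R => `|int_rem x|).
Proof.
move=> x; apply/cvgrPdist_lt => e e0.
apply/nbhs_ballP; exists e => //= y /= xy.
apply: le_lt_trans xy.
have h (z w : R) : `|int_rem z| - `|int_rem w| <= `|z - w|.
  rewrite lerBlDr -{1}(subrK w z); apply: le_trans (int_remD _ _) _.
  by rewrite lerD2r; have := int_rem_min (z - w) 0; rewrite mulr0z subr0.
rewrite ler_norml; apply/andP; split; last exact: h.
by rewrite lerNl opprB (distrC x y); exact: h.
Qed.

End RealLine.

(** * Bilinear interpolation on the squares *)

Section SquareCoordinates.
Variables (R : realType) (S : finType).
Implicit Types l : side S -> R.

Definition bilinear l (s : S) (p : R * R) : R :=
  (1 - p.1) * (1 - p.2) * l (s, @Ordinal 4 0 isT) +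
  p.1 * (1 - p.2) * l (s, @Ordinal 4 1 isT) +
  p.1 * p.2 * l (s, @Ordinal 4 2 isT) +
  (1 - p.1) * p.2 * l (s, @Ordinal 4 3 isT).

Lemma bilinear_side l s k (x : R) :
  bilinear l s (side_pt k x) = (1 - x) * l (s, k) + x * l (next_side (s, k)).
Proof.
rewrite /next_side /=.
have o (i j : 'I_4) : val i = val j -> l (s, i) = l (s, j) by move=> /val_inj ->.
case: k => [[|[|[|[|//]]]] ki]; rewrite /bilinear /side_pt /corner_pt /=.
- rewrite (o (ordS _) (@Ordinal 4 1 isT)) // (o (Ordinal ki) (@Ordinal 4 0 isT)) //.
  by rewrite /GRing.scale /=; ring.
- rewrite (o (ordS _) (@Ordinal 4 2 isT)) // (o (Ordinal ki) (@Ordinal 4 1 isT)) //.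
  by rewrite /GRing.scale /=; ring.
- rewrite (o (ordS _) (@Ordinal 4 3 isT)) // (o (Ordinal ki) (@Ordinal 4 2 isT)) //.
  by rewrite /GRing.scale /=; ring.
- rewrite (o (ordS _) (@Ordinal 4 0 isT)) // (o (Ordinal ki) (@Ordinal 4 3 isT)) //.
  by rewrite /GRing.scale /=; ring.
Qed.

Lemma bilinear_continuous l s : continuous (bilinear l s).
Proof.
move=> p.
have c1 : (fun p : R * R => p.1) p' @[p' --> p] --> p.1 by exact: cvg_fst.
have c2 : (fun p : R * R => p.2) p' @[p' --> p] --> p.2 by exact: cvg_snd.
have c1' : (fun p : R * R => 1 - p.1) p' @[p' --> p] --> 1 - p.1.
  by apply: cvgB => //; exact: cvg_cst.
have c2' : (fun p : R * R => 1 - p.2) p' @[p' --> p] --> 1 - p.2.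
  by apply: cvgB => //; exact: cvg_cst.
by apply: cvgD; [apply: cvgD; [apply: cvgD|]|];
  apply: cvgM; [apply: cvgM| exact: cvg_cst| apply: cvgM| exact: cvg_cst|
   apply: cvgM| exact: cvg_cst|apply: cvgM| exact: cvg_cst].
Qed.

Lemma side_pt_unit k (x : R) : 0 <= x <= 1 -> unit_square (side_pt k x).
Proof.
move=> /andP[x0 x1].
by case: k => [[|[|[|[|//]]]] ki]; rewrite /unit_square /side_pt /corner_pt
  /= /GRing.scale /=; split; apply/andP; split; lra.
Qed.

End SquareCoordinates.

(** * Lifting the interpolated potential over the annulus *)

Section Lifting.
Variables (R : realType) (A : quadriculated_annulus R).
Local Notation annulus := (@circle R `*` `[(0 : R), 1]).

Definition corner_potential (eta : side (square A) -> int)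
    (l : side (square A) -> R) :=
  forall c e, glue A c = Some e -> l (next_side e) = l c + (eta c)%:~R.

(** The interpolation is affine on each side, and across a glued side [d] its values at both ends
    change by the same integer [eta d]; hence so does the value at every point of the side. *)
Lemma bilinear_glued eta l : dual_cocycle (glue A) eta ->
  corner_potential eta l ->
  forall sp sp' : square A * (R * R), glued_pts (glue A) sp sp' ->
  exists n : int, bilinear l sp'.1 sp'.2 = bilinear l sp.1 sp.2 + n%:~R.
Proof.
move=> [eta_anti _] lP sp sp'; elim=> {sp sp'} [_ _ [d e x de /andP[x0 x1]]|sp|sp sp' _ [n nE]|
    sp1 sp2 sp3 _ [n nE] _ [m mE]].
- exists (eta d); rewrite /= !bilinear_side -!surjective_pairing (lP _ _ de).
  rewrite (lP _ _ (glue_sym de)) (eta_anti _ _ de) intrN; ring.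
- by exists 0; rewrite mulr0z addr0.
- by exists (- n); rewrite intrN nE addrK.
- by exists (n + m); rewrite intrD addrA -nE.
Qed.

(** [H] picks one real representative at each point. For continuity modulo 1 at [z]: in each square
    the points whose value is at distance at least [e] from [H z] modulo 1 form a compact set, whose
    image is closed and misses [z]; there are finitely many squares. *)
Lemma height_mod1 eta l : dual_cocycle (glue A) eta -> corner_potential eta l ->
  exists H : R * R -> R,
    (forall s p, unit_square p ->
       exists n : int, bilinear l s p = H (emb s p) + n%:~R) /\
    (forall z e, region A z -> 0 < e ->
       \forall z' \near z, region A z' -> `|int_rem (H z' - H z)| < e).
Proof.
move=> eta_cocycle lP.
have /choice[H HP] : forall z : R * R, exists h : R, forall s p,
    unit_square p -> @emb R A s p = z -> exists n : int, bilinear l s p = h + n%:~R.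
  move=> z; have [[s0 _ [p0 p0P p0E]]|zN] := pselect (region A z); last first.
    by exists 0 => s p pP pz; case: zN; exists s => //; exists p.
  exists (bilinear l s0 p0) => s p pP pz.
  apply: (@bilinear_glued eta l eta_cocycle lP (s0, p0) (s, p)).
  by apply/emb_glue => //; rewrite p0E.
exists H; split=> [s p pP|z e zA e0]; first exact: HP.
have [s0 _ [p0 p0P p0E]] := zA.
have near_s (s : square A) : \forall z' \near z, forall p, unit_square p ->
    emb s p = z' -> `|int_rem (bilinear l s p - H z)| < e.
  pose B := [set p : R * R | unit_square p] `&`
    (fun p => `|int_rem (bilinear l s p - H z)|) @^-1` [set x | e <= x].
  have cB : compact B.
    apply: compact_closedI; first exact: itv_rect_compact.
    apply: preimage_closed; last exact: closed_ge.
    move=> p _.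
    apply: (@continuous_comp _ _ _ (fun p => bilinear l s p - H z) (fun x => `|int_rem x|)).
      by apply: cvgB; [exact: bilinear_continuous|exact: cvg_cst].
    exact: int_rem_continuous.
  have : closed (emb s @` B).
    apply: compact_closed; first exact: norm_hausdorff.
    apply: continuous_compact => //.
    by apply: continuous_subspaceW (@emb_continuous R A s) => p [].
  move/closed_openC; rewrite openE => /(_ z) oB.
  have : ~ (emb s @` B) z.
    move=> [p [pP /= pe] pz].
    have [n nE] := HP _ _ _ pP pz.
    by move: pe; rewrite nE addrC addKr int_rem_int normr0 leNgt e0.
  move/oB; rewrite /interior; apply: filterS => z' z'B p pP pz'.
  rewrite ltNge; apply/negP => pe; apply: z'B; exists p => //.
have := @filter_forall _ _ _ (nbhs z) (nbhs_filter z) near_s.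
apply: filterS => z' z'P [s _ [p pP pE]].
have [n nE] := HP _ _ _ pP pE.
have := z'P s p pP pE.
by rewrite nE addrAC int_remDint.
Qed.

(* The two halves y >= 0 and y <= 0 of the annulus are graphs over the
   rectangle below, so no covering of the circle by the line is needed. *)
Definition rect : set (R * R) := [set q | -1 <= q.1 <= 1 /\ 0 <= q.2 <= 1].

(** The sign [sg] selects the upper or lower half circle; clamping makes the map continuous on the
    whole plane with values in the annulus. *)
Definition half (sg : R) (q : R * R) : (R * R) * R :=
  let x := clamp (-1) 1 q.1 in ((x, sg * Num.sqrt (1 - x ^+ 2)), clamp 0 1 q.2).

Lemma half_annulus sg q : sg ^+ 2 = 1 -> annulus (half sg q).
Proof.
move=> sg1; have /andP[x1 x2] : -1 <= clamp (-1) 1 q.1 <= 1 by apply: clampP; lra.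
split; rewrite /= ?in_itv /=; last by apply: clampP; lra.
rewrite /circle /= exprMn sg1 mul1r sqr_sqrtr; first by ring.
by rewrite subr_ge0 -[_ ^+ 2]real_normK ?num_real // expr_le1 // ler_norml x1 x2.
Qed.

Lemma half_continuous sg : continuous (half sg).
Proof.
move=> q.
have c1 : (fun q : R * R => clamp (-1) 1 q.1) q' @[q' --> q] --> clamp (-1) 1 q.1.
  apply: (@continuous_comp _ _ _ fst (clamp (-1) 1)); first exact: cvg_fst.
  exact: clamp_continuous.
have c2 : (fun q : R * R => clamp 0 1 q.2) q' @[q' --> q] --> clamp 0 1 q.2.
  apply: (@continuous_comp _ _ _ snd (clamp 0 1)); first exact: cvg_snd.
  exact: clamp_continuous.
have c3 : (fun q : R * R => sg * Num.sqrt (1 - clamp (-1) 1 q.1 ^+ 2)) q' @[q' --> q]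
    --> sg * Num.sqrt (1 - clamp (-1) 1 q.1 ^+ 2).
  apply: cvgM; first exact: cvg_cst.
  apply: (@continuous_comp _ _ _ (fun q : R * R => 1 - clamp (-1) 1 q.1 ^+ 2) Num.sqrt).
    by apply: cvgB; [exact: cvg_cst|exact: cvgM].
  exact: sqrt_continuous.
exact: (cvg_pair (cvg_pair c1 c3) c2).
Qed.

Lemma halfE sg w : annulus w -> sg ^+ 2 = 1 -> 0 <= sg * w.1.2 ->
  rect (w.1.1, w.2) /\ half sg (w.1.1, w.2) = w.
Proof.
case: w => [[x y] r] [/= xy1]; rewrite in_itv /= => r01 sg1 sgy.
have x1 : -1 <= x <= 1.
  rewrite -ler_norml -(@expr_le1 _ 2) // real_normK ?num_real //.
  by move: xy1; rewrite /circle /= => <-; rewrite lerDl sqr_ge0.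
split => //; rewrite /half /= !clamp_id //; congr ((_, _), _).
rewrite (_ : 1 - x ^+ 2 = (sg * y) ^+ 2); last first.
  by rewrite exprMn sg1 mul1r; move: xy1; rewrite /circle /=; lra.
by rewrite sqrtr_sqr ger0_norm // mulrA -expr2 sg1 mul1r.
Qed.

Lemma rect_compact : compact rect. Proof. exact: itv_rect_compact. Qed.

Lemma rect_star (t : R) q : 0 <= t <= 1 -> rect q -> rect (t *: q).
Proof.
case: q => x y /= /andP[t0 t1] [/= /andP[x0 x1] /andP[y0 y1]].
by rewrite /rect /= /GRing.scale /=; split; apply/andP; split; nra.
Qed.

Section Homeomorphism.
Variables (f : R * R -> (R * R) * R) (g : (R * R) * R -> R * R).
Hypotheses (f_continuous : {within region A, continuous f})
  (g_continuous : {within annulus, continuous g})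
  (f_annulus : forall z, region A z -> annulus (f z))
  (g_region : forall w, annulus w -> region A (g w))
  (gfK : forall z, region A z -> g (f z) = z).

Lemma region_emb (s : square A) p : unit_square p -> region A (emb s p).
Proof. by move=> pP; exists s => //; exists p. Qed.

Definition half_lift (sg : R) (l : side (square A) -> R) (G : R * R -> R) :=
  (forall q, rect q -> {for q, continuous G}) /\
  (forall s p, unit_square p -> 0 <= sg * (f (emb s p)).1.2 ->
     exists n : int,
       bilinear l s p = G ((f (emb s p)).1.1, (f (emb s p)).2) + n%:~R).

(** The two halves meet along the segments over (1, 0) and (-1, 0). The lifts agree on the first, so
    [m] is the monodromy around the hole, up to orientation. *)
Definition annulus_lift (l : side (square A) -> R) (m : int) :=
  exists Gp Gm : R * R -> R, [/\ half_lift 1 l Gp, half_lift (- 1) l Gm,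
    (forall r, 0 <= r <= 1 -> Gp (1, r) = Gm (1, r)) &
    (forall r, 0 <= r <= 1 -> Gp (- 1, r) = Gm (- 1, r) + m%:~R)].

Lemma half_lift_exists sg l (H : R * R -> R) : sg ^+ 2 = 1 ->
  (forall s p, unit_square p ->
     exists n : int, bilinear l s p = H (emb s p) + n%:~R) ->
  (forall z e, region A z -> 0 < e ->
     \forall z' \near z, region A z' -> `|int_rem (H z' - H z)| < e) ->
  exists G, half_lift sg l G /\
    forall q, exists n : int, G q = H (g (half sg q)) + n%:~R.
Proof.
move=> sg1 lH cH.
have ghalf q : region A (g (half sg q)) by exact/g_region/half_annulus.
have cgh (q : R * R) : g (half sg q') @[q' --> q] --> g (half sg q).
  have aq : \forall q' \near q, annulus (half sg q').
    by apply: (@filterE _ (nbhs q) (nbhs_filter q)) => q'; exact: half_annulus.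
  refine (@cvg_within_comp _ _ _ (nbhs q) (nbhs_filter q) annulus (half sg) g
    (half sg q) (@half_continuous sg q) aq (half_annulus q sg1) g_continuous).
have cHgh : continuous_mod1 (fun q : R * R => H (g (half sg q))).
  move=> q e e0.
  have := cgh q _ (cH _ _ (ghalf q) e0).
  by apply: (@filterS _ (nbhs q) (nbhs_filter q)) => q' /=; apply.
have [G [cG GH]] := continuous_mod1_lift rect_compact rect_star cHgh.
exists G; split=> //; split=> // s p pP sgy.
have [n nE] := lH s p pP.
have fw := f_annulus (region_emb s pP).
have [_ hE] := halfE fw sg1 sgy.
have [k kE] := GH ((f (emb s p)).1.1, (f (emb s p)).2).
exists (n - k); rewrite nE kE hE gfK; last exact: region_emb.
by rewrite intrB; ring.
Qed.

Lemma vertical_segment_continuous (G : R * R -> R) (x : R) : -1 <= x <= 1 ->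
  (forall q, rect q -> {for q, continuous G}) ->
  {within `[0, 1], continuous (fun r => G (x, r))}.
Proof.
move=> x1 cG; apply/subspace_continuousP => r r01.
have /cG cGr : rect (x, r) by split => //=; move: r01; rewrite /= in_itv.
apply: cvg_within_filter.
apply: (@continuous_comp _ _ _ (fun r => (x, r)) G) => //.
exact: (@cvg_pair _ _ _ (nbhs r) (nbhs x) (nbhs r) _ _ _ (fun=> x) id (cvg_cst x) cvg_id).
Qed.

(** On each segment common to the two halves, the difference of the lifts is continuous and
    integer-valued, hence constant. *)
Lemma annulus_lift_exists eta l : dual_cocycle (glue A) eta ->
  corner_potential eta l -> exists m, annulus_lift l m.
Proof.
move=> eta_cocycle lP; have [H [lH cH]] := height_mod1 eta_cocycle lP.
have m1 : (-1 : R) ^+ 2 = 1 by rewrite sqrrN expr1n.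
have [Gp [Gpl GpH]] := half_lift_exists (expr1n _ 2) lH cH.
have [Gm [Gml GmH]] := half_lift_exists m1 lH cH.
have diff x r : x ^+ 2 = 1 -> 0 <= r <= 1 ->
    Gp (x, r) - Gm (x, r) = Gp (x, 0) - Gm (x, 0) /\
    exists n : int, Gp (x, r) - Gm (x, r) = n%:~R.
  move=> x1 r01.
  have x11 : -1 <= x <= 1.
    by rewrite -ler_norml -(@expr_le1 _ 2) // real_normK ?num_real // x1.
  have intd r' : exists n : int, Gp (x, r') - Gm (x, r') = n%:~R.
    have [n ->] := GpH (x, r'); have [k ->] := GmH (x, r').
    exists (n - k); rewrite intrB /half /= clamp_id // x1 subrr sqrtr0 !mulr0; ring.
  split=> //.
  apply: (@int_valued_continuous R (fun r => Gp (x, r) - Gm (x, r))) => //.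
  have := vertical_segment_continuous x11 Gpl.1.
  have := vertical_segment_continuous x11 Gml.1.
  by move=> /[swap]; exact: within_continuousB.
have one01 : 0 <= (0 : R) <= 1 by apply/andP; split; lra.
have [_ [n nE]] := diff 1 0 (expr1n _ _) one01.
have [_ [k kE]] := diff (-1) 0 m1 one01.
(* Shifting [Gm] by [n] makes the lifts agree at x = 1 and leaves the difference [k - n] at x =
   -1. *)
exists (k - n), Gp, (fun q => Gm q + n%:~R); split=> //.
- case: Gml => cGm Gml; split=> [q qr|s p pP y0].
    by apply: cvgD; [exact: cGm|exact: cvg_cst].
  have [j ->] := Gml s p pP y0.
  by exists (j - n); rewrite intrB; ring.
- move=> r r01; have [] := diff 1 r (expr1n _ _) r01.
  by rewrite nE => <- _; ring.
- move=> r r01; have [] := diff (-1) r m1 r01.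
  by rewrite kE intrB => <- _; ring.
Qed.

Lemma bilinearD (a b : R) (l1 l2 : side (square A) -> R) s p :
  bilinear (fun c => a * l1 c + b * l2 c) s p =
  a * bilinear l1 s p + b * bilinear l2 s p.
Proof. by rewrite /bilinear; ring. Qed.

Lemma annulus_lift_comb (a b : int) l1 l2 m1 m2 :
  annulus_lift l1 m1 -> annulus_lift l2 m2 ->
  annulus_lift (fun c => a%:~R * l1 c + b%:~R * l2 c) (a * m1 + b * m2).
Proof.
have comb sg G1 G2 : half_lift sg l1 G1 -> half_lift sg l2 G2 ->
    half_lift sg (fun c => a%:~R * l1 c + b%:~R * l2 c)
      (fun q => a%:~R * G1 q + b%:~R * G2 q).
  move=> [c1 L1] [c2 L2]; split=> [q qr|s p pP y0].
    by apply: cvgD; (apply: cvgM; first exact: cvg_cst); [exact: c1|exact: c2].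
  have [n1 e1] := L1 s p pP y0; have [n2 e2] := L2 s p pP y0.
  exists (a * n1 + b * n2); rewrite bilinearD e1 e2 intrD !intrM; ring.
move=> [Gp1 [Gm1 [P1 M1 E1 N1]]] [Gp2 [Gm2 [P2 M2 E2 N2]]].
exists (fun q => a%:~R * Gp1 q + b%:~R * Gp2 q),
  (fun q => a%:~R * Gm1 q + b%:~R * Gm2 q); split; [exact: comb|exact: comb| |].
- by move=> r r01; rewrite E1 // E2.
- by move=> r r01; rewrite N1 // N2 // intrD !intrM; ring.
Qed.

Lemma annulus_closed : closed annulus.
Proof.
have c1 : continuous (fun w : R * R * R => w.1.1).
  by move=> w; apply: (@continuous_comp _ _ _ fst fst); exact: cvg_fst.
have c2 : continuous (fun w : R * R * R => w.1.2).
  by move=> w; apply: (@continuous_comp _ _ _ fst snd); [exact: cvg_fst|exact: cvg_snd].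
have c3 : continuous (fun w : R * R * R => w.2) by move=> w; exact: cvg_snd.
apply: closedI.
  apply: (@preimage_closed _ _ (fun w : R * R * R => w.1.1 ^+ 2 + w.1.2 ^+ 2) [set 1]).
    move=> w _; apply: cvgD; rewrite /=; under eq_cvg do rewrite expr2; rewrite expr2;
      apply: cvgM; by [exact: c1|exact: c2].
  exact: closed_eq.
apply: (@preimage_closed _ _ (fun w : R * R * R => w.2)); last exact: itv_closed.
by move=> w _; exact: c3.
Qed.

(** Without monodromy the two lifts paste to a continuous function on the annulus. On a square its
    difference with the interpolation is continuous and integer-valued, hence constant along the
    segments from corner 0. *)
Lemma annulus_lift0 l : annulus_lift l 0 ->
  exists (U : R * R -> R) (F : square A -> R), forall s p, unit_square p ->
    U (emb s p) = bilinear l s p + F s.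
Proof.
move=> [Gp [Gm [[cGp Gpl] [cGm Gml] E1 Em1]]].
pose V (w : R * R * R) :=
  if 0 <= w.1.2 then Gp (w.1.1, w.2) else Gm (w.1.1, w.2).
have c2 : continuous (fun w : R * R * R => w.1.2).
  by move=> w; apply: (@continuous_comp _ _ _ fst snd); [exact: cvg_fst|exact: cvg_snd].
have c13 (w : R * R * R) : (fun w => (w.1.1, w.2)) w' @[w' --> w] --> (w.1.1, w.2).
  have c1 : (fun w : R * R * R => w.1.1) w' @[w' --> w] --> w.1.1.
    by apply: (@continuous_comp _ _ _ fst fst); exact: cvg_fst.
  have c3 : (fun w : R * R * R => w.2) w' @[w' --> w] --> w.2 by exact: cvg_snd.
  exact: (cvg_pair c1 c3).
have VGm w : annulus w -> w.1.2 <= 0 -> V w = Gm (w.1.1, w.2).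
  case: w => [[x y] r] [/= xy1]; rewrite in_itv /= => r01 y0.
  rewrite /V /=; case: ifPn => // y0'.
  have {y0 y0'} y0 : y = 0 by apply/eqP; rewrite eq_le y0.
  have /eqP : x ^+ 2 = 1 ^+ 2.
    by move: xy1; rewrite /circle /= y0 expr0n addr0 expr1n.
  rewrite eqf_sqr => /orP[] /eqP ->; first exact: E1.
  by rewrite Em1 // mulr0z addr0.
have part (D : set R) (G : R * R -> R) : closed D ->
    (forall q, rect q -> {for q, continuous G}) ->
    (forall w, annulus w -> D w.1.2 -> V w = G (w.1.1, w.2)) ->
    closed (annulus `&` (fun w => w.1.2) @^-1` D) /\
    {within annulus `&` (fun w => w.1.2) @^-1` D, continuous V}.
  move=> cD cG VG; split.
    apply: closedI; first exact: annulus_closed.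
    by apply: preimage_closed => // w _; exact: c2.
  apply/subspace_continuousP => w [aw Dw].
  have VwE := VG w aw Dw.
  have rw : rect (w.1.1, w.2).
    have [h|h] := leP 0 w.1.2.
      by have [] := halfE aw (expr1n _ 2) ltac:(by rewrite mul1r).
    by have [] := @halfE (-1) w aw ltac:(by rewrite sqrrN expr1n)
      ltac:(by rewrite mulN1r oppr_ge0 ltW).
  have cGw : (fun w => G (w.1.1, w.2)) w'
      @[w' --> within (annulus `&` (fun w => w.1.2) @^-1` D) (nbhs w)]
      --> G (w.1.1, w.2).
    apply: cvg_within_filter.
    apply: (@continuous_comp _ _ _ (fun w : R * R * R => (w.1.1, w.2)) G).
      exact: c13.
    exact: cG.
  rewrite -VwE in cGw; apply: cvg_trans cGw; apply: near_eq_cvg.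
  by rewrite near_withinE; near=> w' => -[aw' Dw']; exact/esym/VG.
have [clp cVp] := part [set y | 0 <= y] Gp (@closed_ge _ 0) cGp
  ltac:(by move=> w aw /= y0; rewrite /V y0).
have [clm cVm] := part [set y | y <= 0] Gm (@closed_le _ 0) cGm VGm.
have cV : {within annulus, continuous V}.
  have := withinU_continuous clp clm cVp cVm.
  rewrite -setIUr (_ : _ `|` _ = setT) ?setIT //.
  apply/seteqP; split=> // w _ /=.
  by have [h|h] := leP 0 w.1.2; [left|right; exact: ltW].
have Vl s p : unit_square p -> exists n : int, V (f (emb s p)) - bilinear l s p = n%:~R.
  move=> pP; rewrite /V; case: ifPn => y0.
    have [n ->] := Gpl s p pP ltac:(by rewrite mul1r).
    by exists (- n); rewrite intrN; ring.
  rewrite -ltNge in y0.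
  have [n ->] := Gml s p pP ltac:(by rewrite mulN1r oppr_ge0 ltW).
  by exists (- n); rewrite intrN; ring.
exists (V \o f), (fun s => V (f (emb s 0)) - bilinear l s 0) => s p pP.
pose phi (t : R) := V (f (emb s (t *: p))) - bilinear l s (t *: p).
have segP t : 0 <= t <= 1 -> unit_square (t *: p).
  move: pP; case: p {phi} => x y [/= /andP[x0 x1] /andP[y0 y1]] /andP[t0 t1].
  by rewrite /unit_square /= /GRing.scale /=; split; apply/andP; split; nra.
have cphi : {within `[0, 1], continuous phi}.
  apply/subspace_continuousP => t; rewrite /= in_itv /= => t01.
  have FF : Filter (within `[0, 1] (nbhs t)) by exact: within_filter.
  have near01 (P : R -> Prop) : (forall t', 0 <= t' <= 1 -> P t') ->
      \forall t' \near within `[0, 1] (nbhs t), P t'.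
    by move=> PP; rewrite near_withinE; near=> t'; rewrite /= in_itv => /PP.
  have cseg : t' *: p @[t' --> within `[0, 1] (nbhs t)] --> t *: p.
    by apply: cvg_within_filter; apply: cvgZr_tmp; exact: cvg_id.
  have cemb := @cvg_within_comp _ _ _ _ FF _ _ _ _ cseg (near01 _ segP)
     (segP t t01) (@emb_continuous R A s).
  have cf := @cvg_within_comp _ _ _ _ FF _ _ _ _ cemb
    (near01 _ (fun t' h => region_emb s (segP t' h)))
    (region_emb s (segP t t01)) f_continuous.
  have cVf := @cvg_within_comp _ _ _ _ FF _ _ _ _ cf
    (near01 _ (fun t' h => f_annulus (region_emb s (segP t' h))))
    (f_annulus (region_emb s (segP t t01))) cV.
  apply: cvgB; first exact: cVf.
  apply: cvg_within_filter.
  apply: (@continuous_comp _ _ _ (fun t : R => t *: p) (bilinear l s)).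
    by apply: cvgZr_tmp; exact: cvg_id.
  exact: bilinear_continuous.
have := int_valued_continuous cphi (fun t t01 => Vl s _ (segP t t01)) (t := 1).
rewrite ler01 lexx => /(_ isT); rewrite /phi scale1r scale0r /= => <-.
by rewrite addrC subrK.
Unshelve. all: by end_near.
Qed.

End Homeomorphism.

(* Rationally, the dual complex of the annulus has first cohomology of rank at
   most one. *)
Lemma dual_cocycles_dependent (eta1 eta2 : side (square A) -> int) :
  dual_cocycle (glue A) eta1 -> dual_cocycle (glue A) eta2 ->
  exists (a b : int) (F : square A -> R), (a != 0) || (b != 0) /\
    forall d e, glue A d = Some e ->
      F d.1 - F e.1 = (a * eta1 d + b * eta2 d)%:~R.
Proof.
move=> c1 c2.
have [f [g [[fc gc] fA gA gfK fgK]]] := emb_annulus A.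
have [l1 l1P] := dual_cocycle_corners (@glue_sym R A) R c1.
have [l2 l2P] := dual_cocycle_corners (@glue_sym R A) R c2.
have [m1 L1] := annulus_lift_exists gc fA gA gfK c1 l1P.
have [m2 L2] := annulus_lift_exists gc fA gA gfK c2 l2P.
(* The coefficients are chosen to cancel the monodromies. *)
have [a [b [ab abm]]] : exists a b : int, ((a != 0) || (b != 0)) /\ a * m1 + b * m2 = 0.
  have [m10|m10] := eqVneq m1 0; first by exists 1, 0; rewrite m10 mulr0 mul0r.
  by exists m2, (- m1); rewrite oppr_eq0 m10 orbT; split=> //; ring.
have L := annulus_lift_comb a b L1 L2; rewrite abm in L.
have [U [F UF]] := annulus_lift0 fc fA L.
exists a, b, F; split=> // d e de.
have z01 : 0 <= (0 : R) <= 1 by apply/andP; split; lra.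
have o01 : 0 <= (1 : R) <= 1 by apply/andP; split; lra.
have p1 := side_pt_unit d.2 z01; have p2 := side_pt_unit e.2 o01.
(* The start of [d] is the end of [e]; comparing the two expressions of [U] at this point gives the
   jump of [F]. *)
have embE : emb d.1 (side_pt d.2 0) = emb e.1 (side_pt e.2 1).
  apply/emb_glue => //; apply: rst_step.
  by rewrite -[X in side_pt e.2 X](subr0 1); exact: GlueStep.
have := etrans (esym (UF _ _ p1)) (etrans (congr1 U embE) (UF _ _ p2)).
rewrite !bilinear_side -!surjective_pairing.
rewrite (l1P _ _ de) (l2P _ _ de) intrD !intrM => h; lra.
Qed.

End Lifting.

(** * Integration along walks *)

Section Walks.
Variables (R : realType) (A : quadriculated_annulus R).
Local Notation tail := (side_tail (glue A)).
Local Notation head := (side_head (glue A)).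
Local Notation vert := {set side (square A)}.
Implicit Types (d e : side (square A)) (xi : seq (side (square A))) (v w : vert).

Fixpoint walk v xi w : bool :=
  if xi is d :: xi' then (tail d == v) && walk (head d) xi' w else v == w.

Lemma walk_sum (Z : zmodType) (g : vert -> Z) v xi w : walk v xi w ->
  \sum_(d <- xi) (g (head d) - g (tail d)) = g w - g v.
Proof.
elim: xi v => [v /eqP <-|d xi IH v /= /andP[/eqP <- /IH]].
  by rewrite big_nil subrr.
by rewrite big_cons => ->; rewrite addrC subrKA.
Qed.

Definition relative_cocycle (omega : side (square A) -> int) :=
  [/\ forall d e, glue A d = Some e -> omega e = - omega d,
      forall d, glue A d = None -> omega d = 0 &
      forall s, \sum_(k < 4) omega (s, k) = 0].

Lemma sum_square_coboundary (Z : zmodType) (g : vert -> Z) (s : square A) :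
  \sum_(k < 4) (g (head (s, k)) - g (tail (s, k))) = 0.
Proof.
rewrite sumrB; apply/eqP; rewrite subr_eq0; apply/eqP.
rewrite [RHS](reindex_inj (can_inj (@ordSK 4))) /=.
by [].
Qed.

Lemma coboundary_relative (g : vert -> int) :
  (forall d, glue A d = None -> g (tail d) = g (head d)) ->
  relative_cocycle (fun d => g (head d) - g (tail d)).
Proof.
move=> gb; split.
- move=> d e de; rewrite (glue_tail de) -(glue_head (@glue_sym R A) de); ring.
- by move=> d /gb ->; rewrite subrr.
- by move=> s; exact: sum_square_coboundary.
Qed.

(** The intersection number of [xi] with the dual edge through [d]. *)
Definition crossing xi d : int :=
  (count (pred1 d) xi)%:Z - (count (fun e => glue A d == Some e) xi)%:Z.

Lemma crossing_cons e xi d : crossing (e :: xi) d =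
  (e == d)%:Z - (glue A d == Some e)%:Z + crossing xi d.
Proof. rewrite /crossing /= !PoszD; ring. Qed.

Lemma glueC d e : (glue A d == Some e) = (glue A e == Some d).
Proof. by apply/eqP/eqP => /glue_sym. Qed.

Lemma sum_pred1 (I : finType) (P : pred I) (i : I) :
  \sum_(j | P j) (i == j)%:Z = (P i)%:Z.
Proof.
rewrite big_mkcond (bigD1 i) //= eqxx big1 ?addr0; first by case: (P i).
by move=> j /negPf ji; rewrite eq_sym ji if_same.
Qed.

(** The sum around a vertex counts departures of [xi] minus arrivals; these balance at interior
    vertices because both ends of [xi] lie on the boundary. *)
Lemma crossing_cocycle v xi w : walk v xi w ->
  boundary_vertex (glue A) v -> boundary_vertex (glue A) w ->
  dual_cocycle (glue A) (crossing xi).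
Proof.
move=> xiw bv bw; split=> [d e de|c cN].
  rewrite /crossing opprB; congr (_%:Z - _%:Z); apply: eq_count => x /=.
    by rewrite de (inj_eq Some_inj) eq_sym.
  by rewrite (glue_sym de) (inj_eq Some_inj) eq_sym.
have -> : \sum_(x in tail c) crossing xi x =
    - \sum_(e <- xi) ((head e == tail c)%:Z - (tail e == tail c)%:Z).
  elim: {xiw} xi => [|e xi IH].
    by rewrite big_nil big1 ?oppr0 // => x _; rewrite /crossing /= subrr.
  under eq_bigr do rewrite crossing_cons.
  rewrite big_split /= IH big_cons opprD; congr (_ + _).
  rewrite sumrB sum_pred1 opprB; congr (_%:Z - _).
    by rewrite inE eq_sym side_tailE.
  case ee : (glue A e) => [x0|]; last first.
    rewrite big1; last by move=> x _; rewrite glueC ee.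
    case: eqP => // hc; move: cN; rewrite -hc.
    by rewrite boundary_head.
  under eq_bigr do rewrite glueC ee (inj_eq Some_inj).
  rewrite sum_pred1 inE; congr (nat_of_bool _)%:Z.
  by rewrite (glue_head (@glue_sym R A) ee) eq_sym side_tailE.
have /= -> := walk_sum (fun v => (v == tail c)%:Z) xiw.
case: eqP => [wc|_]; first by rewrite -wc bw in cN.
by case: eqP => [vc|_]; [rewrite -vc bv in cN|rewrite subrr oppr0].
Qed.

(** A glued side of [xi] contributes once as itself and once as its partner, where both factors
    change sign; on an unglued side [omega] vanishes. *)
Lemma crossing_pairing xi omega : relative_cocycle omega ->
  \sum_d crossing xi d * omega d = (\sum_(d <- xi) omega d) *+ 2.
Proof.
move=> [anti bd _]; elim: xi => [|e xi IH].
  by rewrite big_nil mul0rn big1 // => d _; rewrite /crossing subrr mul0r.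
rewrite big_cons mulrnDl -IH.
under eq_bigr do rewrite crossing_cons mulrDl.
rewrite big_split /=; congr (_ + _).
under eq_bigr do rewrite mulrBl.
rewrite sumrB (bigD1 e) //= eqxx mul1r [X in _ + X - _]big1; last first.
  by move=> j /negPf je; rewrite eq_sym je mul0r.
case ee : (glue A e) => [x|]; last first.
  rewrite big1; first by rewrite bd.
  by move=> d _; rewrite glueC ee mul0r.
rewrite (bigD1 x) //= glueC ee eqxx mul1r [X in _ - (_ + X)]big1; last first.
  by move=> j /negPf jx; rewrite glueC ee (inj_eq Some_inj) eq_sym jx mul0r.
by rewrite (anti _ _ ee) !addr0 opprK mulr2n.
Qed.

(** Summation by parts: exchanging glued sides turns the pairing into twice the sum [S] of
    [F d.1 * omega d], and [S] vanishes square by square. *)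
Lemma coboundary_pairing (F : square A -> R) (eta omega : side (square A) -> int) :
  (forall d e, glue A d = Some e -> F d.1 - F e.1 = (eta d)%:~R) ->
  relative_cocycle omega -> \sum_d eta d * omega d = 0.
Proof.
move=> Feta [anti bd sq].
pose tau d := odflt d (glue A d).
have tauK : involutive tau.
  by move=> d; rewrite /tau; case de : (glue A d) => [e|] /=; rewrite ?(glue_sym de) ?de.
pose S := \sum_d F d.1 * (omega d)%:~R.
have S0 : S = 0.
  transitivity (\sum_s \sum_(k < 4) F s * (omega (s, k))%:~R).
    by rewrite pair_bigA; apply: eq_bigr => -[].
  rewrite big1 // => s _.
  by rewrite -mulr_sumr -rmorph_sum /= sq mulr0.
apply/eqP; rewrite -(intr_eq0 R) rmorph_sum /=; apply/eqP.
have SE : S = \sum_d F (tau d).1 * (omega (tau d))%:~R.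
  by rewrite /S (reindex_inj (inv_inj tauK)).
transitivity (S + S); last by rewrite S0 addr0.
rewrite {2}SE /S -big_split /=.
apply: eq_bigr => d _; rewrite intrM /tau.
case de : (glue A d) => [e|] /=; last by rewrite bd // !mulr0 addr0.
by rewrite -(Feta _ _ de) (anti _ _ de) intrN; ring.
Qed.

Lemma outer_adj v w : boundary_adj (glue A) v w -> outer_vertex v -> outer_vertex w.
Proof.
move=> vw [bv [c [vc cl]]]; split.
  case/existsP: vw => d /andP[dN h]; apply/existsP; exists d; rewrite dN /=.
  by case/orP: h => /andP[h1 h2]; rewrite ?h1 ?h2 ?orbT.
exists c; split=> //; apply: connect_trans vc; apply: connect1.
by case/existsP: vw => d h; apply/existsP; exists d; rewrite orbC.
Qed.

Lemma outer_side d : glue A d = None -> outer_vertex (tail d) <-> outer_vertex (head d).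
Proof.
move=> dN; split; apply: outer_adj; apply/existsP; exists d; by rewrite dN !eqxx ?orbT.
Qed.

(* By [dual_cocycles_dependent] the two crossing functions are proportional up
   to a coboundary, and the coboundary of the indicator of the outer boundary
   shows that the ratio is 1. *)
Lemma walk_sum_invariant omega v xi w v' xi' w' : relative_cocycle omega ->
  walk v xi w -> outer_vertex v -> inner_vertex w ->
  walk v' xi' w' -> outer_vertex v' -> inner_vertex w' ->
  \sum_(d <- xi) omega d = \sum_(d <- xi') omega d.
Proof.
move=> om xiw ov iw xiw' ov' iw'.
have [a [b [F [ab Fab]]]] := dual_cocycles_dependent
  (crossing_cocycle xiw ov.1 iw.1) (crossing_cocycle xiw' ov'.1 iw'.1).
have lin om' : relative_cocycle om' ->
    a * (\sum_(d <- xi) om' d) + b * (\sum_(d <- xi') om' d) = 0.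
  move=> h; have := coboundary_pairing Fab h.
  under eq_bigr do rewrite mulrDl -!mulrA.
  rewrite big_split /= -!mulr_sumr !crossing_pairing // !mulrnAr -mulrnDl.
  by move=> /eqP; rewrite mulrn_eq0 => /eqP.
pose o v : int := (`[< outer_vertex v >] : nat)%:Z.
have obd d : glue A d = None -> o (tail d) = o (head d).
  by move=> dN; rewrite /o (asbool_equiv_eq (outer_side dN)).
have := lin _ (coboundary_relative obd).
rewrite (walk_sum o xiw) (walk_sum o xiw') /o.
rewrite (asboolT ov) (asboolT ov') (asboolF iw.2) (asboolF iw'.2) => h.
(* The coboundary of [o] sums to -1 along both walks, so [a + b = 0]. *)
have ba : b = - a by move: h; lia.
have := lin _ om; rewrite ba mulNr -mulrBr => /eqP; rewrite mulf_eq0 subr_eq0.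
by case: eqP => [a0|_ /= /eqP//]; rewrite ba a0 oppr0 eqxx in ab.
Qed.

End Walks.

(** * Tilings of extremal flux *)

Section Cuts.
Variables (R : realType) (A : quadriculated_annulus R).
Local Notation tail := (side_tail (glue A)).
Local Notation head := (side_head (glue A)).
Local Notation vert := {set side (square A)}.
Implicit Types (d e : side (square A)) (xi : seq (side (square A))) (v w : vert).
Implicit Types (P : pred (side (square A))) (t : {set side (square A)}).

Definition step P : rel vert :=
  fun v w => [exists d, [&& P d, tail d == v & head d == w]].

Lemma path_walk P v p : path (step P) v p ->
  exists xi, [/\ walk v xi (last v p), all P xi & map head xi = p].
Proof.
elim: p v => [v _|w p IH v /= /andP[/existsP[d /and3P[Pd dv /eqP dw]] /IH[xi [xiw Pxi xip]]]].
  by exists [::]; split=> //=.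
by exists (d :: xi); split; rewrite /= ?dv ?Pd ?dw ?xip.
Qed.

Lemma walk_sorted v xi w : walk v xi w -> sorted (fun d e => head d == tail e) xi.
Proof.
case: xi => // d xi /= /andP[_]; elim: xi d => //= e xi IH d /andP[ed xiw].
by rewrite eq_sym ed IH.
Qed.

Lemma walk_vertices v xi w : walk v xi w -> v != w ->
  path_vertices xi = v :: map head xi /\ last v (map head xi) = w.
Proof.
case: xi => [/= ->//|d xi /= /andP[/eqP -> xiw] _]; split=> //.
by elim: xi d xiw => [d /eqP|e xi IH d /= /andP[_ /IH]].
Qed.

Lemma sorted_walk v d xi : sorted (fun d e => head d == tail e) (d :: xi) ->
  walk (tail d) (d :: xi) (last v (map head (d :: xi))).
Proof.
rewrite /= eqxx /=; elim: xi d => //= e xi IH d /andP[ed exi].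
by rewrite eq_sym ed IH.
Qed.

Lemma cut_walk xi : is_cut xi ->
  exists v w, [/\ walk v xi w, outer_vertex v & inner_vertex w].
Proof.
case: xi => [|d xi] [srt _ [ov iw] _ _]; first by case: iw => _ /(_ ov).
exists (tail d), (last (tail d) (map head (d :: xi))); split => //.
exact: sorted_walk.
Qed.

(* The path is chosen of minimal length. *)
Lemma connect_cut P v w : outer_vertex v -> inner_vertex w ->
  connect (step P) v w -> exists2 xi, is_cut xi & all P xi.
Proof.
move=> ov iw /connectP[p0 p0P wE].
pose Q n := exists v p, [/\ outer_vertex v, inner_vertex (last v p),
  path (step P) v p, uniq (v :: p) & size p = n].
have exQ : exists n, `[< Q n >].
  rewrite wE in iw; case/shortenP: p0P iw => p pP up _ iw.
  by exists (size p); apply/asboolP; exists v, p.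
have [_ /asboolP[v' [p [ov' iw' pP up <-]]] minp] := ex_minnP exQ.
have {}minp v'' p' : outer_vertex v'' -> inner_vertex (last v'' p') ->
    path (step P) v'' p' -> uniq (v'' :: p') -> (size p <= size p')%N.
  by move=> *; apply: minp; apply/asboolP; exists v'', p'.
have [xi [xiw Pxi xip]] := path_walk pP.
have vw : v' != last v' p by apply/eqP => e; case: iw' => _; rewrite -e.
have [vs ls] := walk_vertices xiw vw.
exists xi => //; rewrite /is_cut vs xip /=; split=> //.
- exact: walk_sorted xiw.
(* Starting at a later outer vertex would give a shorter path. *)
- move=> x; rewrite inE => /orP[/eqP //|xp] ox.
  case/splitPr: xp pP up iw' minp => p1 p2; rewrite cat_path last_cat /= => /and3P[_ _ pP].
  rewrite cat_uniq => /and4P[_ _ _ up] iw' /(_ x p2 ox iw' pP up).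
  by rewrite size_cat /=; lia.
(* By minimality nothing follows the first inner vertex. *)
- move=> x; rewrite inE => /orP[/eqP ->|xp] ix; first by case: ix.
  case/path.splitP: xp pP up iw' minp => p1 p2; rewrite cat_path last_cat last_rcons.
  move=> /andP[pP _]; rewrite -cat_cons cat_uniq => /and3P[up _ _] iw'.
  move=> /(_ v' (rcons p1 x) ov'); rewrite last_rcons => /(_ ix pP up).
  rewrite size_cat -[X in (_ <= X)%N]addn0 leq_add2l leqn0 size_eq0 => /eqP ->.
  by [].
Qed.

Definition separating (X : pred vert) :=
  (forall v, outer_vertex v -> X v) /\ (forall v, inner_vertex v -> ~~ X v).

Lemma separating_side X d : separating X -> glue A d = None ->
  X (tail d) = X (head d).
Proof.
move=> [Xo Xi] dN.
have [ot|not_t] := pselect (outer_vertex (tail d)).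
  by rewrite !Xo //; apply/(outer_side dN).
have not_h : ~ outer_vertex (head d) by move/(outer_side dN).
rewrite (negPf (Xi _ _)) ?(negPf (Xi _ _)) //.
- by split; [exact: boundary_head|].
- by split; [exact: boundary_tail|].
Qed.

(** The separating set consists of the vertices reachable from the outer boundary. *)
Lemma connect_or_separate P :
  (exists v w, [/\ outer_vertex v, inner_vertex w & connect (step P) v w]) \/
  (exists2 X, separating X & forall d, P d -> X (tail d) -> X (head d)).
Proof.
have [h|h] := pselect (exists v w,
  [/\ outer_vertex v, inner_vertex w & connect (step P) v w]); [by left|right].
exists (fun v => `[< exists2 u, outer_vertex u & connect (step P) u v >]).
  split=> v ov; first by apply/asboolP; exists v.
  by apply/asboolP => -[u ou uv]; apply: h; exists u, v.
move=> d Pd /asboolP[u ou uv]; apply/asboolP; exists u => //.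
apply: connect_trans uv (connect1 _).
by apply/existsP; exists d; rewrite Pd !eqxx.
Qed.

Lemma separating_walk X v xi w : separating X ->
  walk v xi w -> outer_vertex v -> inner_vertex w ->
  \sum_(d <- xi) ((X (head d) : nat)%:Z - (X (tail d) : nat)%:Z) = - 1.
Proof.
move=> [Xo Xi] xiw ov iw; rewrite (walk_sum (fun v => (X v : nat)%:Z) xiw).
by rewrite (Xo v ov) (negPf (Xi w iw)).
Qed.

(** * Domino forms and maximal flux, for either choice of the positive color *)

Section Coloring.
Variable col : pred (square A).
Hypothesis col_glue : forall d e, glue A d = Some e -> col e.1 = ~~ col d.1.

Definition domino_sign (s : square A) : int := if col s then 1 else - 1.
Definition domino_form t d : int := if d \in t then domino_sign d.1 else 0.

Lemma domino_sign_glue d e : glue A d = Some e -> domino_sign e.1 = - domino_sign d.1.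
Proof.
move=> /col_glue; rewrite /domino_sign => ->.
by case: (col d.1); rewrite /= ?opprK.
Qed.

Lemma domino_form_square t s : is_tiling t ->
  \sum_(k < 4) domino_form t (s, k) = domino_sign s.
Proof.
move=> [_ /(_ s)[k [kt ku]]].
rewrite (bigD1 k) //= /domino_form kt big1 ?addr0 // => j jk.
by case: ifPn => // /ku e; rewrite e eqxx in jk.
Qed.

(** The sides of one square all carry the same sign, so the sum counts those in [t] and forces
    exactly one. *)
Lemma tiling_of_domino_form t :
  (forall d, d \in t -> exists2 e, glue A d = Some e & e \in t) ->
  (forall s, \sum_(k < 4) domino_form t (s, k) = domino_sign s) -> is_tiling t.
Proof.
move=> tg ts; split=> // s.
have sign0 : domino_sign s != 0 by rewrite /domino_sign; case: (col s).
have /card1P[k kE] : #|[pred k : 'I_4 | (s, k) \in t]| == 1%N.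
  rewrite -eqz_nat -(inj_eq (mulfI sign0)) mulr1 -[X in _ == X]ts.
  rewrite /domino_form -big_mkcond /= sumr_const -mulr_natr natz.
  by [].
exists k; split; first by have := kE k; rewrite !inE eqxx.
by move=> j jt; have := kE j; rewrite !inE jt => /esym/eqP.
Qed.

Lemma tiling_glue t d e : is_tiling t -> glue A d = Some e -> (e \in t) = (d \in t).
Proof.
move=> [tg _] de; apply/idP/idP => /tg[x]; first by rewrite (glue_sym de) => -[<-].
by rewrite de => -[<-].
Qed.

Lemma tiling_boundary t d : is_tiling t -> glue A d = None -> d \notin t.
Proof. by move=> [tg _] dN; apply/negP => /tg[x]; rewrite dN. Qed.

Lemma domino_form_diff_relative t t' : is_tiling t -> is_tiling t' ->
  relative_cocycle (fun d => domino_form t d - domino_form t' d).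
Proof.
move=> tt tt'; split=> [d e de|d dN|s].
- rewrite /domino_form (tiling_glue tt de) (tiling_glue tt' de) (domino_sign_glue de).
  by case: ifP; case: ifP => *; lia.
- by rewrite /domino_form !(negPf (tiling_boundary _ dN)).
- by rewrite sumrB !domino_form_square // subrr.
Qed.

(* Otherwise the vertices reachable from the outer boundary along sides with
   [(d \in t) = col d.1] avoid the inner boundary, and toggling the sides that
   separate them from the other vertices (lowering the height of the latter by
   4) gives a tiling of larger flux. *)
Lemma max_flux_walk xi v w t : walk v xi w -> outer_vertex v -> inner_vertex w ->
  is_tiling t ->
  (forall t', is_tiling t' ->
     \sum_(d <- xi) domino_form t' d <= \sum_(d <- xi) domino_form t d) ->
  exists zeta v' w', [/\ walk v' zeta w', outer_vertex v', inner_vertex w' &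
    all (fun d => (d \in t) == col d.1) zeta].
Proof.
move=> xiw ov iw tt tmax.
have [[v' [w' [ov' iw' /connectP[p pP wE]]]]|[X Xs Xcl]] :=
  connect_or_separate (fun d => (d \in t) == col d.1).
  have [zeta [zw Pz _]] := path_walk pP.
  by exists zeta, v', w'; rewrite wE in iw' *.
pose t' := [set d | (d \in t) (+) (X (tail d) (+) X (head d))]%SET.
have t'E d : domino_form t' d =
    domino_form t d - ((X (head d) : nat)%:Z - (X (tail d) : nat)%:Z).
  rewrite /domino_form /domino_sign inE.
  (* A side leaving [X] violates [(d \in t) = col d.1], so toggling it raises its form by one; a
     side entering [X] is treated through its partner. *)
  have := Xcl d.
  case de : (glue A d) => [e|]; last first.
    by rewrite (separating_side Xs de) addbb addbF => _; ring.
  have := Xcl e.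
  rewrite (glue_tail de) -(glue_head (@glue_sym R A) de) (tiling_glue tt de) (col_glue de).
  by case: (d \in t); case: (col d.1); case: (X (head e)); case: (X (head d)) => //=;
    try (by move=> /(_ isT isT)); try (by move=> _ /(_ isT isT)).
have t't : is_tiling t'.
  apply: tiling_of_domino_form => [d|s].
    rewrite inE; case de : (glue A d) => [e|]; last first.
      by rewrite (separating_side Xs de) addbb addbF (negPf (tiling_boundary tt de)).
    move=> dt'; exists e => //.
    rewrite inE (tiling_glue tt de) -(glue_head (@glue_sym R A) de).
    by rewrite -(glue_tail de) [X (head d) (+) _]addbC.
  under eq_bigr do rewrite t'E.
  rewrite sumrB domino_form_square //.
  by rewrite (sum_square_coboundary (fun v => (X v : nat)%:Z)) subr0.
(* The sum over [xi] would increase by one. *)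
have := tmax _ t't; under eq_bigr do rewrite t'E.
by rewrite sumrB (separating_walk Xs xiw ov iw) opprK gerDl.
Qed.

(** The form of any tiling on [d] is at most 1 if [col d.1] and at most 0 otherwise, with equality
    exactly when [(d \in t') = col d.1]. Along [zeta] the tiling [t] attains these bounds, and by
    [walk_sum_invariant] [t'] has the same sum there, so it attains them all. *)
Lemma max_flux_frozen xi v w t t' zeta v' w' :
  walk v xi w -> outer_vertex v -> inner_vertex w ->
  walk v' zeta w' -> outer_vertex v' -> inner_vertex w' ->
  is_tiling t -> is_tiling t' ->
  \sum_(d <- xi) domino_form t' d = \sum_(d <- xi) domino_form t d ->
  all (fun d => (d \in t) == col d.1) zeta ->
  all (fun d => (d \in t') == col d.1) zeta.
Proof.
move=> xiw ov iw zw ov' iw' tt tt' eqf zt.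
have := walk_sum_invariant (domino_form_diff_relative tt tt') xiw ov iw zw ov' iw'.
rewrite sumrB eqf subrr => /esym.
rewrite big_seq (eq_bigr (fun d => (col d.1 : nat)%:Z - domino_form t' d)); last first.
  move=> d /(allP zt)/eqP dt; rewrite /domino_form /domino_sign dt.
  by case: (col d.1).
rewrite -big_seq => /eqP; rewrite psumr_eq0; last first.
  by move=> d _; rewrite /domino_form /domino_sign; case: ifP; case: (col d.1).
apply: sub_all => d /=; rewrite /domino_form /domino_sign.
by case: (d \in t'); case: (col d.1).
Qed.

(* Dominoes crossing the walk of [max_flux_walk] are common to all tilings of
   maximal flux, so the walk can be pushed around one of their two squares. *)
Lemma max_flux_cut xi t : is_cut xi -> is_tiling t ->
  (forall t', is_tiling t' ->
     \sum_(d <- xi) domino_form t' d <= \sum_(d <- xi) domino_form t d) ->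
  exists2 zeta, is_cut zeta & forall t', is_tiling t' ->
    \sum_(d <- xi) domino_form t' d = \sum_(d <- xi) domino_form t d -> ~~ trespasses t' zeta.
Proof.
move=> /cut_walk[v [w [xiw ov iw]]] tt tmax.
(* The sides that no domino of a maximal tiling crosses. If they do not connect the two boundaries,
   the separating set [X] is constant along [zeta], although it must change from the outer to the
   inner end. *)
pose free d := `[< forall t', is_tiling t' ->
  \sum_(d <- xi) domino_form t' d = \sum_(d <- xi) domino_form t d -> d \notin t' >].
have free_glue d e : glue A d = Some e -> free d -> free e.
  move=> de /asboolP fd; apply/asboolP => t' tt' eqf.
  by rewrite (tiling_glue tt' de) fd.
have [[v1 [w1 [ov1 iw1 c]]]|[X Xs Xcl]] :=
  connect_or_separate (fun d => free d && (glue A d != None)).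
  have [zeta zc /allP zP] := connect_cut ov1 iw1 c.
  exists zeta => // t' tt' eqf; apply/hasPn => d /zP /andP[/asboolP fd _].
  exact: fd.
have Xfree d : free d -> X (tail d) = X (head d).
  move=> fd; case de : (glue A d) => [e|]; last exact: separating_side.
  apply/idP/idP; first by apply: Xcl; rewrite fd de.
  rewrite (glue_tail de) (glue_head (@glue_sym R A) de); apply: Xcl.
  by rewrite (free_glue _ _ de fd) (glue_sym de).
have [zeta [v1 [w1 [zw ov1 iw1 zt]]]] := max_flux_walk xiw ov iw tt tmax.
have := separating_walk Xs zw ov1 iw1.
rewrite big_seq big1 // => d dz.
suff -> : X (head d) = X (tail d) by rewrite subrr.
have [cd|cd] := boolP (col d.1); last first.
  apply/esym/Xfree/asboolP => t' tt' eqf.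
  have /allP/(_ d dz) := max_flux_frozen xiw ov iw zw ov1 iw1 tt tt' eqf zt.
  by rewrite (negPf cd) => /eqP ->.
(* Every maximal tiling covers [d.1] by the domino across [d], so the other three sides of [d.1] are
   free and carry the value of [X] from one end of [d] to the other. *)
have other k : k != d.2 -> X (tail (d.1, k)) = X (tail (d.1, ordS k)).
  move=> kd; apply: Xfree; apply/asboolP => t' tt' eqf.
  have /allP/(_ d dz) := max_flux_frozen xiw ov iw zw ov1 iw1 tt tt' eqf zt.
  rewrite cd => /eqP dt'; apply/negP => kt'.
  have [_ /(_ d.1)[k0 [_ ku]]] := tt'.
  move: kd; rewrite -(ku _ kt') (ku d.2) ?eqxx //.
  by rewrite -surjective_pairing.
rewrite [d in RHS]surjective_pairing {dz} /side_head /next_side.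
case: d cd other => s k /= _ other.
have k4 : ordS (ordS (ordS (ordS k))) = k.
  by apply/val_inj; case: k {other} => [[|[|[|[|]]]]].
rewrite (other (ordS k)); last by case: k {other k4} => [[|[|[|[|]]]]].
rewrite (other (ordS (ordS k))); last by case: k {other k4} => [[|[|[|[|]]]]].
rewrite (other (ordS (ordS (ordS k)))) ?k4 //.
by case: k {other k4} => [[|[|[|[|]]]]].
Qed.

End Coloring.

Lemma domino_form_sum t xi : \sum_(d <- xi) domino_form (@black R A) t d = flux t xi.
Proof.
rewrite /flux; elim: xi => [|d xi IH]; first by rewrite big_nil subrr.
rewrite big_cons IH /= !PoszD /domino_form /domino_sign.
by case: (d \in t); case: (black d.1) => /=; ring.
Qed.

Lemma domino_formC_sum t xi :
  \sum_(d <- xi) domino_form (fun s => ~~ @black R A s) t d = - flux t xi.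
Proof.
rewrite -domino_form_sum -sumrN; apply: eq_bigr => d _; rewrite /domino_form /domino_sign.
by case: (d \in t); case: (black d.1) => /=; rewrite ?opprK ?oppr0.
Qed.

End Cuts.

Theorem theorem3p3 (R : realType) (A : quadriculated_annulus R)
    (tileable : exists t : {set side (square A)}, is_tiling t)
    (xi : seq (side (square A))) (xi_cut : is_cut xi)
    (fmax fmin : int)
    (fmaxP : is_max_flux xi fmax) (fminP : is_min_flux xi fmin) :
  exists xi_max xi_min : seq (side (square A)),
    [/\ is_cut xi_max, is_cut xi_min,
        (forall t : {set side (square A)},
           is_tiling t -> flux t xi = fmax -> ~~ trespasses t xi_max) &
        (forall t : {set side (square A)},
           is_tiling t -> flux t xi = fmin -> ~~ trespasses t xi_min)].
Proof.
have [[tmax tmaxP tmaxE] maxP] := fmaxP.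
have [[tmin tminP tminE] minP] := fminP.
have [|xi_max cmax maxc] :=
  @max_flux_cut R A (@black R A) (@black_glue R A) xi tmax xi_cut tmaxP.
  by move=> t tt; rewrite !domino_form_sum tmaxE; exact: maxP.
have whiteP d e : glue A d = Some e -> ~~ black e.1 = ~~ ~~ black d.1.
  by move=> /black_glue ->.
(* With the colors exchanged the sum of the domino form is minus the flux, so [tmin] maximizes
   it. *)
have [|xi_min cmin minc] :=
  @max_flux_cut R A (fun s => ~~ @black R A s) whiteP xi tmin xi_cut tminP.
  by move=> t tt; rewrite !domino_formC_sum tminE lerN2; exact: minP.
exists xi_max, xi_min; split=> // t tt tE.
- by apply: maxc => //; rewrite !domino_form_sum tE tmaxE.
- by apply: minc => //; rewrite !domino_formC_sum tE tminE.
Qed.
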